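(* Let $p$ be a prime, $d \geq 1$, $V = \mathbb{F}_p^d$, and let $G \leq \mathrm{GL}(V)$ be an irreducible linear group on $V$ such that $p$ divides $|G|$ (so that the affine group $VG$ is a finite primitive permutation group on $V$). Then $\overrightarrow{\mathrm{diam}}(V, G) \leq 9d^3$.
   Context: Vectors are row vectors and $G$ acts on $V$ by right multiplication. The affine group $VG$ is the permutation group $\{ v \mapsto b + vA \mid b \in V, A \in G\}$ on $V$. Its orbital graphs are the orbits of $VG$ on $V \times V$ (viewed as directed graphs on $V$); the nondiagonal ones are exactly the Cayley digraphs on $V$ whose connection set is a nonzero orbit $\mathcal{O}$ of $G$ on $V$, i.e. with an arc $u \to u + w$ for every $u \in V$, $w \in \mathcal{O}$. The directed diameter of such a graph is the maximal directed distance between two vertices (following arcs in their orientation). $\overrightarrow{\mathrm{diam}}(V, G)$ denotes the maximum of the directed diameters of all nondiagonal orbital graphs of $VG$; equivalently, it is the least positive integer $m$ such that $m \cdot (\mathcal{O} \cup \{0\}) = V$ for every nonzero orbit $\mathcal{O}$ of $G$ on $V$, where for a subset $\Delta \subseteq V$, $m \cdot \Delta$ denotes the $m$-fold sumset $\{\delta_1 + \dots + \delta_m \mid \delta_i \in \Delta\}$. *)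

(* Defs.v *)
From HB Require Import structures.
From mathcomp Require Import all_boot all_order all_algebra all_fingroup all_solvable mxrepresentation mxabelem.
Set Implicit Arguments. Unset Strict Implicit. Unset Printing Implicit Defensive.
Import GRing.Theory.
Local Open Scope ring_scope.

(* V = 'rV['F_p]_d (row vectors), G a subgroup of {'GL_d['F_p]} acting by
   right multiplication v |-> v *m A. Dimension d is written n.+1 (d >= 1). *)

Definition Gorbit (p n : nat) (G : {group {'GL_n.+1['F_p]}}) (v : 'rV['F_p]_n.+1)
  : {set 'rV['F_p]_n.+1} := [set v *m GLval (A : {'GL_n.+1['F_p]}) | A in G].

Fixpoint sumset (p n : nat) (m : nat) (D : {set 'rV['F_p]_n.+1}) : {set 'rV['F_p]_n.+1} :=
  match m with
  | O => [set 0]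
  | m'.+1 => [set x + y | x in D, y in sumset m' D]
  end.

Definition diam_property (p n : nat) (G : {group {'GL_n.+1['F_p]}}) (m : nat) : Prop :=
  forall v : 'rV['F_p]_n.+1, v != 0 ->
    sumset m (0 |: Gorbit G v) = [set: 'rV['F_p]_n.+1].

(* dirdiam(V,G) <= k : the least positive m with diam_property exists and is <= k *)
Definition dirdiam_le (p n : nat) (G : {group {'GL_n.+1['F_p]}}) (k : nat) : Prop :=
  exists m : nat, [/\ (0 < m)%N, (m <= k)%N & diam_property G m].

Definition irreducible_GL (p n : nat) (G : {group {'GL_n.+1['F_p]}}) : Prop :=
  mx_irreducible (subg_repr (GLrepr 'F_p n) (subsetT G)).

(* Main.v *)
(** A sumset containing a translate [b + W] of a subspace [W] is enlarged until
    [W = V]. By irreducibility there are [x] in the orbit, [g] in [G] of order [p]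
    and [h] in [G] with [x (g - 1) h] outside [W]. The orbit then contains the
    polynomial curve [i |-> x g^i h = sum_j 'C(i, j) u_j], of degree at most [d - 1].
    If [p] is small, [p - 1] copies of two points of the curve fill a line modulo
    [W]. Otherwise the curve modulo [W] has, in suitable coordinates, entries of
    distinct degrees, and with [r] such coordinates [r d (d - 1)] points of the
    curve suffice to fill its span. Hence at most [d^3] orbit elements are used.

    The filling is a Combinatorial Nullstellensatz argument. If some target is
    missed, then the numbers of ways of distributing all linear factors among the
    variables with prescribed degrees vanish mod [p]. Weighting these numbers by
    values, in an algebraic closure of [F_p], of [k]-tuples with a single nonzero
    power sum among the first [k] forces a product of multinomial coefficients
    [(p-1)! / prod n_x!] to vanish mod [p], which is absurd. *)
Require Import Defs.
From HB Require Import structures.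
From mathcomp Require Import all_boot all_order all_algebra all_fingroup all_solvable mxrepresentation mxabelem.
From mathcomp Require Import closed_field finfield.
From mathcomp Require Import zify ring.
Set Implicit Arguments. Unset Strict Implicit. Unset Printing Implicit Defensive.
Import GRing.Theory.
Local Open Scope ring_scope.

(** * Coefficient extraction over ['F_p] and weighted counts of assignments *)

(** The substitution x -> u x multiplies the sum by u^e, so the sum vanishes once some nonzero u has
    u^e distinct from 1. For e = 0 the convention 0^0 = 1 makes the sum equal to p, hence 0. *)
Lemma sum_Fp_expr (p : nat) (e : nat) : prime p -> (e <= p.-1)%N ->
  \sum_(x : 'F_p) x ^+ e = - (e == p.-1)%:R.
Proof.
move=> p_pr le_e; have p_gt1 := prime_gt1 p_pr.
have [->|e_gt0] := posnP e.
  under eq_bigr do rewrite expr0.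
  rewrite sumr_const (card_Fp p_pr) pchar_Fp_0 // -subn1.
  by rewrite eq_sym subn_eq0 leqNgt p_gt1 oppr0.
have [->|ne_e] := eqVneq e p.-1.
  rewrite (bigD1 0) //= expr0n; have -> : p.-1 == 0%N = false by apply/negbTE; lia.
  rewrite add0r (eq_bigr (fun _ => 1)) => [|x x_neq0].
    rewrite sumr_const; have -> : #|[pred x : 'F_p | x != 0]| = p.-1.
      by have := cardC1 (0 : 'F_p); rewrite card_Fp // => <-; apply: eq_card.
    by apply/eqP; rewrite -addr_eq0 -mulrSr prednK ?pchar_Fp_0 //; lia.
  apply: (mulfI x_neq0); rewrite mulr1 -exprS prednK ?(prime_gt0 p_pr) //.
  by rewrite -[in RHS](expf_card x) card_Fp.
(* The polynomial X^e - 1 has at most e < p - 1 roots, so some nonzero element is not a root. *)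
have /existsP[u /andP[u_neq0 ue_neq1]] :
    [exists u : 'F_p, (u != 0) && (u ^+ e != 1)].
  apply: contraT => /existsPn all1.
  have := @max_poly_roots _ ('X^e - 1) [seq x <- enum 'F_p | x != 0].
  rewrite size_XnsubC // -size_poly_eq0 size_XnsubC //.
  have -> : size [seq x <- enum 'F_p | x != 0] = p.-1.
    have := cardC1 (0 : 'F_p); rewrite card_Fp // => <-; rewrite cardE.
    by rewrite [in RHS]/enum_mem [in LHS]enumT.
  rewrite filter_uniq ?enum_uniq // => /(_ isT) H.
  suff: (p.-1 < e.+1)%N by move=> ?; lia.
  apply: H => //; apply/allP => x; rewrite mem_filter => /andP[x_neq0 _].
  by rewrite rootE !hornerE subr_eq0; have := all1 x; rewrite x_neq0 negbK.
set s := \sum_x _; have : u ^+ e * s = s.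
  rewrite {2}/s (reindex_inj (mulfI u_neq0)) /= mulr_sumr.
  by apply: eq_bigr => x _; rewrite exprMn.
move/eqP; rewrite -subr_eq0 -{2}[s]mul1r -mulrBl mulf_eq0 subr_eq0.
by rewrite (negbTE ue_neq1) oppr0 => /eqP.
Qed.

(** The weight moves degree a to p - 1 and every smaller degree to an exponent below p - 1, whose
    power sum vanishes. *)
Lemma sum_Fp_horner (p a : nat) (Q : {poly 'F_p}) : prime p ->
    (a <= p.-1)%N -> (size Q <= a.+1)%N ->
  \sum_(x : 'F_p) x ^+ (p.-1 - a) * Q.[x] = - Q`_a.
Proof.
move=> p_pr le_a szQ.
under eq_bigr do rewrite (horner_coef_wide _ szQ) mulr_sumr.
rewrite exchange_big /= big_ord_recr /= big1 ?add0r => [|i _].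
  under eq_bigr do rewrite mulrCA -exprD subnK //.
  by rewrite -mulr_sumr sum_Fp_expr // eqxx mulrN1.
under eq_bigr do rewrite mulrCA -exprD.
rewrite -mulr_sumr sum_Fp_expr //; last by have := ltn_ord i; lia.
case: eqP => [E|_]; last by rewrite oppr0 mulr0.
by have := ltn_ord i; lia.
Qed.

Lemma coef_prod_top (R : comNzRingType) (I : finType) (A : pred I)
    (Q : I -> {poly R}) (d : I -> nat) :
    (forall i, A i -> (size (Q i) <= (d i).+1)%N) ->
  (size (\prod_(i | A i) Q i)%R <= (\sum_(i | A i) d i).+1)%N
  /\ (\prod_(i | A i) Q i)`_(\sum_(i | A i) d i) = \prod_(i | A i) (Q i)`_(d i).
Proof.
move=> szQ; apply: (big_rec3 (fun (P : {poly R}) D c =>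
  (size P <= D.+1)%N /\ P`_D = c)) => [|i P D c Ai [szP cP]].
  by rewrite size_poly1 coef1.
have szQi := szQ i Ai; split.
  apply: leq_trans (size_polyMleq _ _) _.
  by rewrite -subn1 leq_subLR; apply: leq_trans (leq_add szQi szP) _; rewrite addSn addnS.
rewrite coefM (bigD1 (inord (d i))) //= inordK ?ltnS ?leq_addr // addKn cP.
rewrite big1 ?addr0 // => j ne_j.
have [lt_j|le_j] := ltnP (d i) j.
  by rewrite nth_default ?mul0r //; apply: leq_trans szQi lt_j.
rewrite [P`_ _]nth_default ?mulr0 //; apply: leq_trans szP _.
suff : (j : nat) != d i by have := ltn_ord j; lia.
by apply: contraNneq ne_j => E; apply/eqP/val_inj; rewrite /= E inordK // ltnS leq_addr.
Qed.

(* The sum of [prod_s sum_j P_(s,j)(y_j) * prod_j y_j^(p-1-a_j)] over all [y] picks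
   out the coefficient of [prod_j y_j^(a_j)] in the top-degree form. *)
Lemma weighted_fiber_count0 (p : nat) (S J : finType) (l : S -> nat)
    (P : S -> J -> {poly 'F_p}) (lc : S -> 'F_p) (a : J -> nat) :
    prime p ->
    (forall s j, (size (P s j) <= (l s).+1)%N) ->
    (forall s j, (P s j)`_(l s) = lc s) ->
    (forall s, lc s != 0) ->
    (forall j, (a j <= p.-1)%N) ->
    (\sum_j a j = \sum_s l s)%N ->
    (forall y : {ffun J -> 'F_p}, \prod_s \sum_j (P s j).[y j] = 0) ->
  (p %| #|[set f : {ffun S -> J} | [forall j, (\sum_(s | f s == j) l s)%N == a j]]|)%N.
Proof.
move=> p_pr szP lcP lc_neq0 le_a sum_a F0.
set X := [set f | _].
pose w (y : {ffun J -> 'F_p}) := \prod_j (y j) ^+ (p.-1 - a j).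
have : \sum_y w y * \prod_s \sum_j (P s j).[y j] = 0.
  by apply: big1 => y _; rewrite F0 mulr0.
under eq_bigr do rewrite bigA_distr_bigA /= mulr_sumr.
rewrite exchange_big /=.
pose T (f : {ffun S -> J}) j :=
  \sum_(x : 'F_p) x ^+ (p.-1 - a j) * (\prod_(s | f s == j) P s j).[x].
(* For a fixed assignment [f] of factors to variables, the sum over [y] splits into a product of
   one-variable sums. *)
have TE (f : {ffun S -> J}) :
    \sum_y w y * \prod_s (P s (f s)).[y (f s)] = \prod_j T f j.
  rewrite /T bigA_distr_bigA /=; apply: eq_bigr => y _.
  rewrite big_split /=; congr (_ * _).
  rewrite (partition_big f predT) //=; apply: eq_bigr => j _.
  by rewrite horner_prod; apply: eq_bigr => s /eqP->.
under eq_bigr do rewrite TE.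
have TX f : f \in X -> \prod_j T f j = (-1) ^+ #|J| * \prod_s lc s.
  rewrite inE => /forallP fX.
  have Tj j : T f j = - \prod_(s | f s == j) lc s.
    have [|sz cf] := @coef_prod_top _ _ (fun s => f s == j) (fun s => P s j) l.
      by move=> s _; apply: szP.
    move: sz cf; rewrite (eqP (fX j)) => sz cf.
    by rewrite /T sum_Fp_horner // cf; under eq_bigr do rewrite lcP.
  under eq_bigr do rewrite Tj.
  by rewrite prodrN [in RHS](partition_big f predT).
(* The total degree is fixed, so an assignment outside [X] gives some variable [j] a degree below
   [a j], and the coefficient extracted there is zero. *)
have TnX f : f \notin X -> \prod_j T f j = 0.
  rewrite inE => /forallPn[j0 ne_j0].
  have dsum : (\sum_j \sum_(s | f s == j) l s = \sum_j a j)%N.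
    by rewrite sum_a [RHS](partition_big f predT).
  have /existsP[j lt_j] : [exists j, (\sum_(s | f s == j) l s < a j)%N].
    apply: contraT => /existsPn ge_a; have : (\sum_j a j < \sum_j \sum_(s | f s == j) l s)%N.
      rewrite (bigD1 j0) //= [ltnRHS](bigD1 j0) //= -addSn leq_add //.
        by rewrite ltn_neqAle eq_sym ne_j0 leqNgt ge_a.
      by apply: leq_sum => j _; rewrite leqNgt ge_a.
    by rewrite dsum ltnn.
  have [|sz cf] := @coef_prod_top _ _ (fun s => f s == j) (fun s => P s j) l.
    by move=> s _; apply: szP.
  rewrite (bigD1 j) //= /T sum_Fp_horner //; last first.
    exact: leq_trans sz (leqW lt_j).
  by rewrite nth_default ?oppr0 ?mul0r //; apply: leq_trans sz lt_j.
rewrite (bigID (mem X)) /= [X in _ + X]big1 // addr0 (eq_bigr _ TX) sumr_const.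
move/eqP; rewrite -mulr_natr mulf_eq0 mulf_eq0 signr_eq0 /=.
rewrite prodf_seq_eq0; case: hasP => [[s _ /= /eqP lc0]|_ /=].
  by have := lc_neq0 s; rewrite lc0 eqxx.
by rewrite -(dvdn_pcharf (pchar_Fp p_pr)).
Qed.

(* Sums the previous congruence over all [a] with block sums [b], with weight
   [prod_(i,t) c_(i,t)^(a_(i,t))]. *)
Lemma weighted_block_sum0 (p : nat) (K : fieldType) (S B C : finType)
    (l : S -> nat) (b : B -> nat) (c : B -> C -> K) :
    p \in [pchar K] ->
    (forall i, (b i <= p.-1)%N) ->
    (forall a : B * C -> nat, (forall j, (a j <= p.-1)%N) ->
       (\sum_j a j = \sum_s l s)%N ->
       (p %| #|[set f : {ffun S -> B * C} |
                 [forall j, (\sum_(s | f s == j) l s)%N == a j]]|)%N) ->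
  \sum_(g : {ffun S -> B} | [forall i, (\sum_(s | g s == i) l s)%N == b i])
     \prod_s \sum_(t : C) c (g s) t ^+ l s = 0.
Proof.
move=> pK le_b H.
pose d (f : {ffun S -> B * C}) (j : B * C) := (\sum_(s | f s == j) l s)%N.
pose Q (f : {ffun S -> B * C}) := [forall i, (\sum_(s | (f s).1 == i) l s)%N == b i].
have p_gt0 := prime_gt0 (pcharf_prime pK).
(* Expanding each inner sum chooses an element of [C] for every slot; together with [g] these
   choices form one map into [B * C]. *)
transitivity (\sum_(f | Q f) \prod_s c (f s).1 (f s).2 ^+ l s).
  under eq_bigr do rewrite bigA_distr_bigA /=.
  rewrite pair_big_dep /=.
  rewrite (reindex (fun f : {ffun S -> B * C} =>
     ([ffun s => (f s).1], [ffun s => (f s).2]))) /=; last first.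
    exists (fun gh : {ffun S -> B} * {ffun S -> C} => [ffun s => (gh.1 s, gh.2 s)]).
      by move=> f _; apply/ffunP => s; rewrite !ffunE; case: (f s).
    by move=> [g h] _ /=; congr (_, _); apply/ffunP => s; rewrite !ffunE.
  apply: eq_big => [f|f _]; last by apply: eq_bigr => s _; rewrite !ffunE.
  by rewrite andbT; apply: eq_forallb => i; congr (_ == _); apply: eq_bigl => s; rewrite ffunE.
have dle f j : Q f -> (d f j < p)%N.
  move=> /forallP/(_ j.1)/eqP bj; rewrite -(prednK p_gt0) ltnS.
  apply: leq_trans (le_b j.1); rewrite -bj /d [leqRHS](bigID (fun s => f s == j)) /=.
  rewrite (eq_bigl (fun s => ((f s).1 == j.1) && (f s == j))) ?leq_addr //.
  by move=> s; case: (f s =P j) => [->|]; rewrite ?eqxx ?andbF.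
(* Assignments are grouped by their degree vector, which determines the summand. By [dle] its
   entries are below p, so [inord] loses nothing. *)
rewrite (partition_big (fun f => [ffun j => inord (d f j) : 'I_p.-1.+1]) predT) //=.
apply: big1 => a _.
have [/pred0P none|/pred0Pn[f0 /andP[Qf0 /eqP af0]]] := boolP (pred0b
  (fun f => Q f && ([ffun j => inord (d f j) : 'I_p.-1.+1] == a))).
  by rewrite big_pred0.
have da f : Q f -> ([ffun j => inord (d f j) : 'I_p.-1.+1] == a) = [forall j, d f j == a j].
  move=> Qf; apply/eqP/forallP => [<- j|H1].
    by rewrite ffunE inordK ?prednK ?dle.
  by apply/ffunP => j; rewrite ffunE (eqP (H1 j)) inord_val.
(* Block sums depend only on the degree vector, so one member [f0] of the class satisfying [Q]
   settles [Q] for the whole class. *)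
have Qa f : [forall j, d f j == a j] -> Q f.
  move=> /forallP fa; apply/forallP => i; move: (Qf0) => /forallP/(_ i)/eqP <-.
  rewrite (partition_big f (fun j => j.1 == i)) //= [X in _ == X](partition_big f0 (fun j => j.1 == i)) //=.
  apply/eqP/eq_bigr => j /eqP j1.
  have : d f j = d f0 j.
    by rewrite (eqP (fa j)) -af0 ffunE inordK ?prednK ?dle.
  rewrite /d => E; rewrite (eq_bigl (fun s => f s == j)); last first.
    by move=> s; rewrite andbC; case: eqP => // ->; rewrite j1 eqxx.
  rewrite [RHS](eq_bigl (fun s => f0 s == j)); last first.
    by move=> s; rewrite andbC; case: eqP => // ->; rewrite j1 eqxx.
  exact: E.
rewrite (eq_bigl (mem [set f | [forall j, d f j == a j]])); last first.
  move=> f; rewrite [RHS]/= !inE; apply/idP/idP => [/andP[Qf]|fa]; first by rewrite da.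
  by rewrite (Qa _ fa) /= da ?(Qa _ fa).
rewrite (eq_bigr (fun _ => \prod_j c j.1 j.2 ^+ a j)); last first.
  move=> f; rewrite /= !inE => /forallP fa; rewrite (partition_big f predT) //=.
  apply: eq_bigr => j _; rewrite -(eqP (fa j)) /d expr_sum.
  by apply: eq_bigr => s /eqP ->.
rewrite sumr_const; apply/eqP; rewrite -mulr_natr mulf_eq0; apply/orP; right.
rewrite -(dvdn_pcharf pK); apply: H => [j|]; first by rewrite -ltnS.
rewrite (partition_big f0 predT) //=; apply: eq_bigr => j _.
by rewrite -af0 ffunE inordK ?prednK ?dle.
Qed.

(** * Tuples with a single nonzero power sum *)

(** Newton's identities: the logarithmic derivative E'/E = - sum_c c / (1 - c X), cleared of
    denominators, with the geometric series cut off at X^k. *)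
Lemma deriv_prod_geometric (R : comNzRingType) (k : nat) (s : seq R) :
  exists Q : {poly R}, (\prod_(c <- s) (1 - c *: 'X))^`() +
    \prod_(c <- s) (1 - c *: 'X) * \sum_(h < k) (\sum_(c <- s) c ^+ h.+1) *: 'X^h
  = 'X^k * Q.
Proof.
elim: s => [|c s [Q IH]].
  exists 0; rewrite !big_nil derivC mul1r mulr0 add0r big1 // => h _.
  by rewrite big_nil scale0r.
set E := \prod_(_ <- s) _ in IH *; set T := \sum_(_ < _) _ in IH *.
exists ((1 - c *: 'X) * Q - (c ^+ k.+1) *: E).
rewrite big_cons -/E.
have -> : \sum_(h < k) (\sum_(c0 <- c :: s) c0 ^+ h.+1) *: 'X^h =
          T + c *: \sum_(h < k) (c *: 'X) ^+ h.
  rewrite scaler_sumr -big_split; apply: eq_bigr => h _ /=.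
  by rewrite big_cons scalerDl addrC exprZn scalerA exprS.
rewrite -!mul_polyC rmorphXn /=; set G := \sum_(_ < k) _.
have geo : (1 - c%:P * 'X) * G = 1 - c%:P ^+ k * 'X^k.
  by rewrite /G -[RHS]opprB -exprMn subrX1 -[RHS]mulNr opprB.
have -> : ((1 - c%:P * 'X) * E)^`() = (1 - c%:P * 'X) * E^`() - c%:P * E.
  by rewrite derivM derivB -polyC1 derivM !derivC derivX; ring.
transitivity ((1 - c%:P * 'X) * (E^`() + E * T) + E * c%:P * ((1 - c%:P * 'X) * G - 1)).
  by ring.
by rewrite IH geo exprS; ring.
Qed.

(* [E] is the truncation of [exp(- X^l)]; its reciprocal roots have [l]-th power
   sum [l] and vanishing other power sums. *)
Lemma truncated_exp_split (K : closedFieldType) (p k l : nat) :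
    p \in [pchar K] -> (0 < l <= k)%N -> (k < p)%N ->
  exists s : k.-tuple K, exists Q : {poly K}, let E := \prod_(c <- s) (1 - c *: 'X) in
  E.[0] = 1 /\ E^`() = - (l%:R *: ('X^(l.-1) * E)) + 'X^k * Q.
Proof.
move=> pK /andP[l_gt0 le_lk] lt_kp.
have p_pr := pcharf_prime pK.
pose J := (k %/ l)%N.
have lJ : (l * J <= k)%N by rewrite mulnC leq_trunc_div.
have lJ1 : (k < l * J.+1)%N by rewrite mulnC ltn_ceil.
(* The coefficients of exp(-X); the factorials are invertible since j <= J <= k < p. *)
pose e j : K := (-1) ^+ j / j`!%:R.
pose E : {poly K} := \sum_(j < J.+1) e j *: 'X^(l * j).
have nat_neq0 j : (0 < j)%N -> (j < p)%N -> j%:R != 0 :> K.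
  by move=> j0 jp; rewrite -(dvdn_pcharf pK) gtnNdvd.
have eS j : (j < J)%N -> e j.+1 *+ (l * j.+1) = - (e j *+ l).
  move=> lt_jJ; rewrite /e exprS factS natrM invfM mulnC mulrnA -[_ *+ j.+1]mulr_natr.
  have -> : -1 * (-1) ^+ j * (j.+1%:R^-1 * j`!%:R^-1) * j.+1%:R = - ((-1) ^+ j / j`!%:R) :> K.
    have j_neq0 : j.+1%:R != 0 :> K.
      by apply: nat_neq0 => //; apply: leq_ltn_trans lt_kp; apply: leq_trans lJ; nia.
    by rewrite mulN1r mulNr mulNr; congr (- _); rewrite [_^-1 * _]mulrC mulrA mulfVK.
  by rewrite mulNrn.
have szE : (size E <= (l * J).+1)%N.
  apply: leq_trans (size_sum _ _ _) _; apply/bigmax_leqP => j _.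
  apply: leq_trans (size_scale_leq _ _) _; rewrite size_polyXn ltnS leq_mul2l.
  by rewrite -ltnS ltn_ord orbT.
have E0 : E.[0] = 1.
  rewrite /E big_ord_recl /= hornerD hornerZ muln0 expr0 hornerC /e expr0 fact0 divr1 mulr1.
  rewrite horner_sum big1 ?addr0 // => i _.
  by rewrite hornerZ hornerXn /bump /= expr0n muln_eq0 addn_eq0 (gtn_eqF l_gt0) mulr0.
have dE : exists Q, E^`() = - (l%:R *: ('X^(l.-1) * E)) + 'X^k * Q.
  (* Only the last term of the truncation spoils the equation E' = - l X^(l-1) E; its degree l J + l
     - 1 is at least k because k < l (J + 1). *)
  exists (l%:R *: (e J *: 'X^(l * J + l.-1 - k))).
  rewrite {1}/E big_ord_recl derivD /= muln0 expr0 derivZ derivC scaler0 add0r.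
  have -> : (\sum_(i < J) e (lift ord0 i) *: 'X^(l * lift ord0 i))^`() =
            - (l%:R *: ('X^(l.-1) * \sum_(i < J) e i *: 'X^(l * i))).
    rewrite raddf_sum /= mulr_sumr scaler_sumr -sumrN; apply: eq_bigr => j _.
    rewrite derivZ derivXn -scalerMnr scalerMnl eS //.
    rewrite -scalerAr -exprD scalerA mulr_natl scaleNr.
    by congr (- (_ *: 'X^_)); rewrite mulnS; lia.
  rewrite [in RHS]/E big_ord_recr /= [in RHS]mulrDr scalerDr opprD -addrA.
  rewrite -!scalerAr -!exprD.
  have -> : (k + (l * J + l.-1 - k) = l.-1 + l * J)%N.
    by rewrite subnKC; [rewrite addnC | move: lJ1; rewrite mulnS; lia].
  by rewrite addNr addr0.
have [r Er] := closed_field_poly_normal E.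
have E_neq0 : E != 0 by apply: contra_eqN E0 => /eqP->; rewrite horner0 eq_sym oner_eq0.
have szr : (size r <= k)%N.
  have := szE; rewrite Er size_scale ?lead_coef_eq0 // size_prod_XsubC ltnS.
  by move=> h; apply: leq_trans lJ.
have r_neq0 z : z \in r -> z != 0.
  move=> zr; apply/eqP => z0; have : root E z.
    by rewrite Er rootZ ?lead_coef_eq0 // root_prod_XsubC.
  by rewrite z0 rootE E0 oner_eq0.
(* Past the end of [r] the default 0 has inverse 0, which pads the tuple to length k with trivial
   factors 1 - 0 X. *)
pose s := [seq (nth 0 r i)^-1 | i <- iota 0 k].
have Es : E = \prod_(c <- s) (1 - c *: 'X).
  rewrite /s big_map -[k in iota 0 k](subnKC szr) iotaD big_cat /= [X in _ * X]big1_seq; last first.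
    move=> i /=; rewrite mem_iota => /andP[ri _].
    by rewrite nth_default ?invr0 ?scale0r ?subr0.
  rewrite mulr1.
  have -> : \prod_(i <- iota 0 (size r)) (1 - (nth 0 r i)^-1 *: 'X) =
            \prod_(z <- r) (1 - z^-1 *: 'X : {poly K}).
    by rewrite [RHS](big_nth 0) /index_iota subn0.
  have Er' : E = (lead_coef E * \prod_(z <- r) (- z)) *: \prod_(z <- r) (1 - z^-1 *: 'X).
    rewrite {1}Er -scalerA; congr (_ *: _).
    rewrite -[in RHS]mul_polyC rmorph_prod /= -big_split big_seq [RHS]big_seq.
    apply: eq_bigr => z /r_neq0 z0 /=.
    rewrite mul_polyC scalerBr scalerA mulNr mulfV // scaleN1r opprK.
    by rewrite addrC alg_polyC polyCN.
  have : E.[0] = lead_coef E * \prod_(z <- r) - z.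
    rewrite {1}Er' hornerZ horner_prod [X in _ * X]big1_seq ?mulr1 // => z _.
    by rewrite !hornerE /= ?mulr0 subr0.
  by rewrite E0 => h; rewrite {1}Er' -h scale1r.
have sz_s : size s == k by rewrite size_map size_iota.
by have [Q dEQ] := dE; exists (Tuple sz_s), Q; rewrite /= -Es.
Qed.

(** The two preceding lemmas both express the derivative of E modulo X^k. Since E(0) = 1, E can be
    cancelled there, and the generating polynomial of the first k power sums is l X^(l-1). *)
Lemma pure_power_sums (K : closedFieldType) (p k l : nat) :
    p \in [pchar K] -> (0 < l <= k)%N -> (k < p)%N ->
  exists c : 'I_k -> K, forall m, (0 < m <= k)%N ->
    \sum_i c i ^+ m = (if m == l then l else 0)%:R.
Proof.
move=> pK /andP[l_gt0 le_lk] lt_kp.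
have [|s [Q2]] := @truncated_exp_split K p k l pK _ lt_kp; first exact/andP.
set E := \prod_(c <- s) _ => /= -[E0 E2].
have [Q1] := deriv_prod_geometric k s; rewrite -/E E2.
set S := \sum_(h < k) _ => E1.
have dvd : 'X^k %| E * (S - l%:R *: 'X^(l.-1)).
  apply/dvdpP; exists (Q1 - Q2).
  have aux (a x y f t q : {poly K}) :
      f * (t - a * x) = - (a * (x * f)) + y * q + f * t - y * q by ring.
  by rewrite mulrBl ![_ * 'X^k]mulrC -E1 -!mul_polyC; apply: aux.
have S0 : S = l%:R *: 'X^(l.-1).
  apply/eqP; rewrite -subr_eq0; apply: contraTT dvd => neq0.
  have cop : coprimep 'X^k E.
    by apply: coprimep_expl; rewrite coprimep_sym coprimepX rootE E0 oner_eq0.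
  rewrite (Gauss_dvdpr _ cop).
  apply/negP => /(dvdp_leq neq0); rewrite size_polyXn; apply/negP; rewrite -leqNgt.
  apply: leq_trans (size_polyD _ _) _; rewrite geq_max size_polyN; apply/andP; split.
    apply: leq_trans (size_sum _ _ _) _; apply/bigmax_leqP => h' _.
    by apply: leq_trans (size_scale_leq _ _) _; rewrite size_polyXn.
  by apply: leq_trans (size_scale_leq _ _) _; rewrite size_polyXn prednK.
exists (fun i => s`_i) => m /andP[m_gt0 le_mk].
have m1k : (m.-1 < k)%N by rewrite prednK.
have := congr1 (fun P : {poly K} => P`_(m.-1)) S0.
rewrite coefZ coefXn coef_sum (bigD1 (Ordinal m1k)) //=.
rewrite [X in _ + X](_ : _ = 0); last first.
  apply: big1 => i ne_i; rewrite coefZ coefXn; case: eqP => [e1|_]; last by rewrite mulr0.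
  by case/eqP: ne_i; apply: val_inj.
rewrite addr0 coefZ coefXn eqxx mulr1 prednK // (big_nth 0) size_tuple big_mkord => ->.
have -> : (m.-1 == l.-1) = (m == l) by rewrite -eqSS !prednK.
by case: eqP; rewrite ?mulr1 ?mulr0.
Qed.

(** * Multinomial counts modulo p *)

Lemma count_enum (T : finType) (a : pred T) : count a (enum T) = #|[pred t | a t]|.
Proof. by rewrite -sum1_count -sum1_card big_enum_cond; apply: eq_bigl. Qed.

(** Words with letters in [A] and prescribed content [n]; for [T] of size sum_x n_x their number is
    the multinomial coefficient. *)
Definition fiber_sizes (A T : finType) (n : A -> nat) : {set {ffun T -> A}} :=
  [set f : {ffun T -> A} | [forall x, #|[pred t | f t == x]| == n x]].

Lemma fiber_sizes_neq0 (A : finType) (N : nat) (n : A -> nat) :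
  (\sum_x n x)%N = N -> fiber_sizes 'I_N n != set0.
Proof.
move=> sumn; pose t := flatten [seq nseq (n x) x | x <- enum A].
have szt : size t == N.
  rewrite size_flatten /shape -map_comp (eq_map (g := n)); last by move=> x; rewrite /= size_nseq.
  by rewrite sumnE big_map big_enum sumn.
apply/set0Pn; exists [ffun i => tnth (Tuple szt) i]; rewrite inE; apply/forallP => x.
have -> : #|[pred i | [ffun i => tnth (Tuple szt) i] i == x]| = count_mem x t.
  transitivity (count_mem x [seq tnth (Tuple szt) i | i <- enum 'I_N]).
    by rewrite count_map count_enum; apply: eq_card => i; rewrite !inE ffunE.
  by rewrite map_tnth_enum.
rewrite count_flatten -map_comp sumnE big_map big_enum /= (bigD1 x) //=.
rewrite count_nseq /= eqxx mul1n big1 ?addn0 // => y ne_yx.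
by rewrite count_nseq /= (negbTE ne_yx).
Qed.

(** Permuting positions acts transitively on the words of given content, and the size of an orbit
    divides the order of the symmetric group. *)
Lemma card_fiber_sizes_dvd_fact (A : finType) (N : nat) (n : A -> nat) (f0 : {ffun 'I_N -> A}) :
  f0 \in fiber_sizes 'I_N n -> (#|fiber_sizes 'I_N n| %| N`!)%N.
Proof.
move=> f0n.
pose act (f : {ffun 'I_N -> A}) (s : {perm 'I_N}) := [ffun i => f (s^-1%g i)].
have act_is : is_action [set: {perm 'I_N}] act.
  split=> [s f g /ffunP fg|f s u _ _].
    by apply/ffunP => i; have := fg (s i); rewrite !ffunE permK.
  by apply/ffunP => i; rewrite !ffunE invMg permM.
pose to := Action act_is.
suff -> : fiber_sizes 'I_N n = orbit to [set: {perm 'I_N}]%G f0.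
  by rewrite -card_Sn -cardsT; apply: dvdn_orbit.
apply/setP => f; apply/idP/orbitP => [fn|[s _ <-]].
  have : perm_eq [tuple f i | i < N] [tuple f0 i | i < N].
    apply/allP => x _; apply/eqP.
    move: fn f0n; rewrite !inE => /forallP/(_ x)/eqP fx /forallP/(_ x)/eqP f0x.
    have cE (g : {ffun 'I_N -> A}) :
        count_mem x (map g (enum 'I_N)) = #|[pred t | g t == x]|.
      by rewrite count_map count_enum.
    by rewrite [LHS](etrans (cE f) fx); symmetry; rewrite -f0x; apply: cE.
  case/tuple_permP => s fs; exists s^-1%g => //; apply/ffunP => i.
  rewrite /= ffunE invgK.
  have := congr1 (fun t => nth (f i) t i) fs.
  by rewrite -!tnth_nth !tnth_mktuple.
move: f0n; rewrite !inE => /forallP f0n; apply/forallP => x; rewrite -(eqP (f0n x)).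
rewrite -!sum1_card (reindex_inj (@perm_inj _ s)) /=; apply/eqP/eq_bigl => i.
by rewrite !inE ffunE permK.
Qed.

(** These are the assignments that survive the weighting by power sums: slots of index [i] go to
    blocks of index [i], and block [(i, x)] receives exactly [n i x] of them when [l i] is
    positive. *)
Definition pair_fiber_sizes (p : nat) (I A : finType) (l : I -> nat) (n : I -> A -> nat) :
    {set {ffun I * 'I_p.-1 -> I * A}} :=
  [set g : {ffun I * 'I_p.-1 -> I * A} | [forall s, (g s).1 == s.1]
    && [forall x, (\sum_(s | g s == x) l s.1)%N == (l x.1 * n x.1 x.2)%N]].

(** The set is a product over [i] of sets of words of content [n i]. Each factor has size dividing
    (p-1)!, which is prime to p by Wilson's theorem. *)
Lemma pair_fiber_sizes_ndvd (p : nat) (I A : finType) (l : I -> nat) (n : I -> A -> nat) :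
    prime p -> (forall i, 0 < l i)%N -> (forall i, \sum_x n i x = p.-1)%N ->
  ~~ (p %| #|pair_fiber_sizes p l n|)%N.
Proof.
move=> p_pr l_gt0 sumn.
pose F i := fiber_sizes 'I_p.-1 (n i).
pose h (u : {ffun I -> {ffun 'I_p.-1 -> A}}) : {ffun I * 'I_p.-1 -> I * A} :=
  [ffun s => (s.1, u s.1 s.2)].
have sumE u i x : (\sum_(s | h u s == (i, x)) l s.1 = l i * #|[pred t | u i t == x]|)%N.
  rewrite -sum1_card big_distrr /=.
  rewrite (reindex_onto (fun t => (i, t)) snd) /=; last first.
    by move=> [j t]; rewrite /h ffunE /= xpair_eqE => /andP[/eqP-> _].
  apply: eq_big => [t|t _]; last by rewrite muln1.
  by rewrite /h ffunE /= xpair_eqE !eqxx andbT.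
have -> : pair_fiber_sizes p l n = h @: [set u | u \in family (fun i => mem (F i))].
  apply/setP => g; apply/idP/imsetP => [|[u uF ->]]; rewrite inE.
    case/andP=> /forallP g1 /forallP gn.
    have gE : g = h [ffun i => [ffun t => (g (i, t)).2]].
      apply/ffunP => -[i t]; rewrite /h !ffunE /=; have /= := g1 (i, t).
      by case: (g _) => j x /= /eqP->.
    exists [ffun i => [ffun t => (g (i, t)).2]] => //.
    rewrite inE; apply/familyP => i; rewrite inE /=; apply/forallP => x.
    have := gn (i, x); rewrite gE sumE eqn_pmul2l //.
    by rewrite /h; congr (_ == _); apply: eq_card => t; rewrite !inE !ffunE.
  move: uF; rewrite inE => /familyP uF; apply/andP; split; apply/forallP.
    by move=> s; rewrite ffunE.
  move=> [i x]; rewrite sumE eqn_pmul2l //=.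
  by have := uF i; rewrite inE => /forallP.
rewrite card_imset; last first.
  move=> u v /ffunP huv; apply/ffunP => i; apply/ffunP => t.
  by have := huv (i, t); rewrite !ffunE => -[].
rewrite cardsE card_family foldrE big_map big_enum /=.
rewrite Euclid_dvd_prod // big_has; apply/hasPn => i _; apply/negP.
have [f0 f0F] := set0Pn _ (fiber_sizes_neq0 (sumn i)).
have -> : #|mem (F i)| = #|fiber_sizes 'I_p.-1 (n i)| by apply: eq_card.
move=> /dvdn_trans/(_ (card_fiber_sizes_dvd_fact f0F)) p_dvd.
have := p_pr; rewrite Wilson ?prime_gt1 // -addn1 dvdn_addr // dvdn1.
by move/eqP => p1; have := prime_gt1 p_pr; rewrite p1.
Qed.

(** * Prescribing sums of polynomial values *)

(** Take l parts equal to N / l and one part N mod l. The latter is below l, so l times it is at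
    most l^2 <= k^2 <= N; the l + 1 nonzero parts at most fit into k + 1 places. *)
Lemma split_exponent (k l N : nat) : (0 < l <= k)%N -> (k ^ 2 <= N)%N ->
  exists n : 'I_k.+1 -> nat, (\sum_x n x = N)%N /\ forall x, (l * n x <= N)%N.
Proof.
move=> /andP[l_gt0 le_lk] le_kN.
pose n (x : nat) := if (x < l)%N then (N %/ l)%N else if x == l then (N %% l)%N else 0%N.
exists (fun x : 'I_k.+1 => n x); split.
  rewrite -(big_mkord xpredT n) (big_cat_nat (n := l)) //=; last by lia.
  rewrite big_nat (eq_bigr (fun _ => (N %/ l)%N)) => [|x /andP[_ lt_xl]]; last by rewrite /n lt_xl.
  rewrite -big_nat sum_nat_const_nat subn0 big_ltn //.
  rewrite big_nat big1 => [|x /andP[lt_lx _]]; last first.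
    by rewrite /n ltnNge (ltnW lt_lx) /= gtn_eqF.
  by rewrite /n ltnn eqxx addn0 mulnC -divn_eq.
move=> x; rewrite /n; case: ifP => _; first by rewrite mulnC leq_trunc_div.
case: ifP => _; last by rewrite muln0.
apply: leq_trans le_kN; apply: (@leq_trans (l * l)%N); last by rewrite -mulnn leq_mul.
by rewrite leq_mul2l ltnW ?ltn_pmod ?orbT.
Qed.

(* The slot [(i, s)] carries the factor [sum_j P_i(y_j) - t_i - (s + 1)], so the
   product over all slots is nonzero exactly at the solutions. *)
Lemma horner_sums_surj (p k : nat) (I : finType) (l : I -> nat)
    (P : I -> {poly 'F_p}) (t : I -> 'F_p) :
    prime p -> (k ^ 2 <= p.-1)%N -> injective l ->
    (forall i, 0 < l i <= k)%N -> (forall i, size (P i) = (l i).+1) ->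
  exists y : (I * 'I_k.+1) * 'I_k -> 'F_p, forall i, \sum_j (P i).[y j] = t i.
Proof.
move=> p_pr le_kp l_inj lk szP.
have p_gt1 := prime_gt1 p_pr; have p_gt0 := prime_gt0 p_pr.
have [/existsP[y /forallP yt]|/existsPn noy] := boolP
    [exists y : {ffun (I * 'I_k.+1) * 'I_k -> 'F_p},
      [forall i, \sum_j (P i).[y j] == t i]].
  by exists y => i; apply/eqP.
exfalso.
have /forallPn[i0 _] := noy [ffun=> 0].
have k_gt0 : (0 < k)%N by have := lk i0; lia.
have lt_kp : (k < p)%N.
  by rewrite -(prednK p_gt0) ltnS; apply: leq_trans le_kp; rewrite -mulnn leq_pmulr.
pose j0 : (I * 'I_k.+1) * 'I_k := ((i0, ord0), Ordinal k_gt0).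
(* The constant is charged to a single variable [j0], so that each factor is a
   plain sum over the variables. *)
pose Ps (s : I * 'I_p.-1) (j : (I * 'I_k.+1) * 'I_k) : {poly 'F_p} :=
  P s.1 - (if j == j0 then t s.1 + s.2.+1%:R else 0)%:P.
(* If the equation of index [i] fails at [y], the discrepancy [d] is a nonzero residue, hence equals
   s + 1 for a slot s < p - 1, and the factor of that slot vanishes. *)
have F0 (y : {ffun (I * 'I_k.+1) * 'I_k -> 'F_p}) : \prod_s \sum_j (Ps s j).[y j] = 0.
  have /forallPn[i ne_i] := noy y.
  pose d := \sum_j (P i).[y j] - t i.
  have d_gt0 : (0 < nat_of_ord d)%N.
    by rewrite lt0n; apply: contra ne_i => /eqP d0; rewrite -subr_eq0; apply/eqP/val_inj.
  have d_lt : ((nat_of_ord d).-1 < p.-1)%N.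
    by rewrite -ltnS !prednK //; apply: leq_trans (ltn_ord d) _; rewrite Fp_cast.
  have dE : (Ordinal d_lt).+1%:R = d by rewrite -[RHS]natr_Zp; congr _%:R; apply: prednK.
  apply/eqP/prodf_eq0; exists (i, Ordinal d_lt) => //.
  rewrite /Ps; under eq_bigr do rewrite hornerD hornerN hornerC.
  rewrite big_split sumrN -big_mkcond big_pred1_eq.
  have -> : t (i, Ordinal d_lt).1 + (i, Ordinal d_lt).2.+1%:R = \sum_j (P i).[y j].
    by rewrite dE addrC subrK.
  by apply/eqP; apply: subrr.
have [K [io _]] := countable_algebraic_closure 'F_p.
have pK : p \in [pchar K] by rewrite (fmorph_pchar io) pchar_Fp.
have /fin_all_exists[c cE] : forall i, exists c : 'I_k -> K, forall m, (0 < m <= k)%N ->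
    \sum_j c j ^+ m = (if m == l i then l i else 0)%:R.
  by move=> i; apply: pure_power_sums pK (lk i) lt_kp.
have /fin_all_exists2[n sumn le_n] : forall i, exists2 n : 'I_k.+1 -> nat,
    (\sum_x n x = p.-1)%N & forall x, (l i * n x <= p.-1)%N.
  by move=> i; have [n [? ?]] := split_exponent (lk i) le_kp; exists n.
pose lS (s : I * 'I_p.-1) := l s.1.
have := @weighted_block_sum0 p K _ (I * 'I_k.+1)%type 'I_k lS
  (fun x => l x.1 * n x.1 x.2)%N (fun x => c x.1) pK (fun x => le_n x.1 x.2).
have Hcount (a : I * 'I_k.+1 * 'I_k -> nat) : (forall j, (a j <= p.-1)%N) ->
    (\sum_j a j = \sum_s lS s)%N ->
    (p %| #|[set f : {ffun I * 'I_p.-1 -> I * 'I_k.+1 * 'I_k} |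
        [forall j, (\sum_(s | f s == j) lS s)%N == a j]]|)%N.
  move=> le_a sum_a.
  apply: (weighted_fiber_count0 (P := Ps) (lc := fun s => lead_coef (P s.1))) => //.
  - move=> s j; apply: leq_trans (size_polyD _ _) _; rewrite geq_max szP leqnn size_polyN.
    by apply: leq_trans (size_polyC_leq1 _) _.
  - move=> s j; rewrite coefB coefC lead_coefE szP /lS.
    by have /andP[l0 _] := lk s.1; rewrite (gtn_eqF l0) subr0.
  - by move=> s; rewrite lead_coef_eq0 -size_poly_gt0 szP.
move=> /(_ Hcount) sum0.
have l_gt0 i : (0 < l i)%N by have /andP[] := lk i.
have := pair_fiber_sizes_ndvd p_pr l_gt0 sumn; rewrite (dvdn_pcharf pK).
(* The common value of all surviving terms: a slot of index [i] sent to a block of index [i]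
   contributes the power sum l_i, nonzero mod p as 0 < l_i <= k < p. *)
pose M : K := \prod_(s : I * 'I_p.-1) (l s.1)%:R.
have M_neq0 : M != 0.
  apply/prodf_neq0 => s _; rewrite -(dvdn_pcharf pK) gtnNdvd //.
  by apply: leq_ltn_trans lt_kp; have /andP[] := lk s.1.
apply/negP; rewrite negbK -(mulIr_eq0 _ (mulIf M_neq0)) mulr_natl -sumr_const.
apply/eqP; rewrite -[RHS]sum0.
rewrite [RHS](bigID (fun g : {ffun I * 'I_p.-1 -> I * 'I_k.+1} => [forall s, (g s).1 == s.1])) /=.
(* A slot sent to a block of another index contributes a power sum with the wrong exponent, which is
   0; injectivity of [l] enters here. *)
rewrite [X in _ = _ + X]big1 ?addr0 => [|g /andP[_ /forallPn[s ne_s]]]; last first.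
  apply/eqP/prodf_eq0; exists s => //; rewrite cE ?lk // (inj_eq l_inj) [s.1 == _]eq_sym.
  by rewrite (negbTE ne_s).
apply: eq_big => [g|g]; first by rewrite inE andbC.
rewrite inE => /andP[/forallP g1 _]; apply: eq_bigr => s _.
by rewrite cE ?lk // (eqP (g1 s)) /lS eqxx.
Qed.

(** * Iterated sumsets and binomial polynomials *)

Lemma sumsetD (p n a b : nat) (D : {set 'rV['F_p]_n.+1}) x y :
  x \in sumset a D -> y \in sumset b D -> x + y \in sumset (a + b) D.
Proof.
elim: a x => [|a IH] x /=; first by rewrite inE => /eqP->; rewrite add0r.
case/imset2P=> u v uD va -> yb; rewrite -addrA.
by apply: imset2_f => //; apply: IH.
Qed.

Lemma sumset_sum (p n : nat) (D : {set 'rV['F_p]_n.+1}) (J : finType) (f : J -> 'rV_n.+1) :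
  (forall j, f j \in D) -> \sum_j f j \in sumset #|J| D.
Proof.
move=> fD; rewrite -big_enum cardT; elim: (enum J) => [|j s IH].
  by rewrite big_nil inE.
by rewrite big_cons; apply: imset2_f.
Qed.

Lemma sumset_leq (p n a b : nat) (D : {set 'rV['F_p]_n.+1}) x :
  0 \in D -> (a <= b)%N -> x \in sumset a D -> x \in sumset b D.
Proof.
move=> D0 /subnK <- xa; rewrite -[x]add0r; apply: sumsetD => //.
elim: (b - a)%N => [|m IH]; first by rewrite inE.
by rewrite /= -[0]addr0; apply: imset2_f.
Qed.

(** The binomial coefficient X choose j as a polynomial; the inverse of j! is genuine only for j <
    p. *)
Definition bin_poly (p j : nat) : {poly 'F_p} :=
  j`!%:R^-1 *: \prod_(h <- iota 0 j) ('X - h%:R%:P).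

Lemma natr_Fp_neq0 (p m : nat) : prime p -> (0 < m < p)%N -> m%:R != 0 :> 'F_p.
Proof.
by move=> p_pr /andP[m0 mp]; rewrite -(dvdn_pcharf (pchar_Fp p_pr)) gtnNdvd.
Qed.

Lemma fact_Fp_neq0 (p j : nat) : prime p -> (j < p)%N -> j`!%:R != 0 :> 'F_p.
Proof.
move=> p_pr; elim: j => [|j IH] lt_jp; first by rewrite oner_eq0.
by rewrite factS natrM mulf_neq0 ?IH ?natr_Fp_neq0 // ltnW.
Qed.

Lemma size_bin_poly (p j : nat) : prime p -> (j < p)%N -> size (bin_poly p j) = j.+1.
Proof.
move=> p_pr lt_jp; rewrite size_scale ?invr_eq0 ?fact_Fp_neq0 //.
by rewrite -(big_map (fun h => h%:R) xpredT (fun z => 'X - z%:P)) size_prod_XsubC size_map size_iota.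
Qed.

Lemma horner_bin_poly (p j : nat) (x : 'F_p) : prime p -> (j < p)%N ->
  (bin_poly p j).[x] = 'C(x, j)%:R.
Proof.
move=> p_pr lt_jp; rewrite hornerZ horner_prod.
apply: (mulfI (fact_Fp_neq0 p_pr lt_jp)); rewrite mulVKf ?fact_Fp_neq0 //.
rewrite -natrM mulnC bin_ffact -[k in iota 0 k]subn0 -/(index_iota 0 j) big_mkord.
have {lt_jp} ffE m i : (m%:R : 'F_p) = x -> \prod_(h < i) ('X - h%:R%:P).[x] = (m ^_ i)%:R.
  move=> <-; elim: i => [|j' IH]; first by rewrite big_ord0 ffactn0.
  rewrite big_ord_recr /= IH hornerXsubC ffactnSr natrM.
  have [le_jm|lt_mj] := leqP j' m; first by rewrite natrB.
  by rewrite ffact_small // !mul0r.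
by apply: ffE; apply: natr_Zp.
Qed.

(** * Enlarging a covered subspace *)

(** The translation [b] is left free because the steps below fill cosets; it becomes harmless once
    [W] is the whole space. *)
Definition covers (p n : nat) (D : {set 'rV['F_p]_n.+1}) (W : 'M['F_p]_n.+1) (m : nat) : Prop :=
  exists b : 'rV['F_p]_n.+1, forall v : 'rV['F_p]_n.+1, (v <= W)%MS -> b + v \in sumset m D.

(** Using c copies of y and p - 1 - c copies of x gives (p - 1) x + c (y - x), and c runs through
    all residues. *)
Lemma covers_line_step (p n m : nat) (D : {set 'rV['F_p]_n.+1}) (W : 'M['F_p]_n.+1) x y :
    prime p -> x \in D -> y \in D -> ~~ (y - x <= W)%MS -> covers D W m ->
  exists W' : 'M_n.+1, (\rank W < \rank W')%N /\ covers D W' (m + p.-1).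
Proof.
move=> p_pr xD yD ndW [b bW].
exists (W + <<(y - x)%R>>)%MS; split.
  apply: rank_ltmx; rewrite ltmxE addsmxSl; apply: contra ndW.
  by apply: submx_trans; apply: submx_trans (addsmxSr _ _); rewrite genmxE.
exists (b + x *+ p.-1) => v.
case/sub_addsmxP=> -[a1 a2] /= ->.
have : (a2 *m <<(y - x)%R>> <= y - x)%MS by rewrite (submx_trans (submxMl _ _)) ?genmxE.
case/sub_rVP=> c ->.
have c_le : (nat_of_ord c <= p.-1)%N.
  rewrite -ltnS prednK ?prime_gt0 //; apply: leq_trans (ltn_ord c) _.
  by rewrite Fp_cast.
have multD (z : 'rV_n.+1) k : z \in D -> z *+ k \in sumset k D.
  move=> zD; have := sumset_sum (J := 'I_k) (f := fun=> z) (fun=> zD).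
  by rewrite sumr_const card_ord.
have -> : b + x *+ p.-1 + (a1 *m W + c *: (y - x)) =
    (b + a1 *m W) + (y *+ c + x *+ (p.-1 - c)).
  have -> : c *: (y - x) = y *+ c - x *+ c.
    by rewrite -mulrnBl -[in RHS]scaler_nat natr_Zp.
  rewrite -[in LHS](subnK c_le) mulrnDr addrACA; congr (_ + _).
  by rewrite addrC [x *+ _ + _]addrC addrA subrK.
apply: sumsetD; first by apply: bW; rewrite submxMl.
by rewrite -(subnKC c_le); apply: sumsetD; rewrite ?subnKC //; apply: multD.
Qed.

(** Each coordinate of the curve modulo [W] costs (n + 1) n points, and there are at most as many
    coordinates as the rank gained. The condition on [u 1] makes the gain positive. *)
Lemma covers_curve_step (p n m : nat) (D : {set 'rV['F_p]_n.+1}) (W : 'M['F_p]_n.+1)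
    (u : nat -> 'rV['F_p]_n.+1) :
    prime p -> (0 < n)%N -> (n ^ 2 <= p.-1)%N -> 0 \in D ->
    (forall i : nat, \sum_(j < n.+1) u j *+ 'C(i, j) \in D) ->
    ~~ (u 1%N <= W)%MS -> covers D W m ->
  exists W' : 'M_n.+1, (\rank W < \rank W')%N /\
    covers D W' (m + (\rank W' - \rank W) * (n.+1 * n)).
Proof.
move=> p_pr n_gt0 le_np D0 uD nu1W [b bW].
have p_gt0 := prime_gt0 p_pr.
have lt_np : (n < p)%N.
  by rewrite -(prednK p_gt0) ltnS; apply: leq_trans le_np; rewrite -mulnn leq_pmulr.
(* [T e] is [W] plus the span of the last [e] vectors [u_(n-e+1), ..., u_n]; the
   curve has a coordinate of degree [n - e] modulo [W] exactly when [L e]. *)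
pose T := fix T e : 'M['F_p]_n.+1 :=
  if e is e'.+1 then (<<u (n - e')%N>> + T e')%MS else W.
have T_S e : (T e.+1 = <<u (n - e)%N>> + T e)%MS by [].
have T_mono e f : (e <= f)%N -> (T e <= T f)%MS.
  move=> /subnK <-; elim: (f - e)%N => // k /submx_trans; apply.
  by rewrite addSn T_S addsmxSr.
have u_T e f : (n - f < e <= n)%N -> (u e <= T f)%MS.
  move=> /andP[fe en]; apply: (submx_trans _ (T_mono (n - e).+1 f _)); last by lia.
  by rewrite T_S subKn //; apply: submx_trans (addsmxSl _ _); rewrite genmxE.
pose L e := ~~ (u (n - e)%N <= T e)%MS.
have rankT k : (\rank W + \sum_(e < k) L e <= \rank (T k))%N.
  elim: k => [|k IH]; first by rewrite big_ord0 addn0.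
  rewrite big_ord_recr /= addnA; apply: leq_trans (leq_add IH (leqnn _)) _.
  rewrite /L; case: (boolP (u (n - k)%N <= T k)%MS) => [_|ndu] /=.
    by rewrite addn0 mxrankS // (T_mono k k.+1).
  rewrite addn1; apply: rank_ltmx; rewrite ltmxE addsmxSr; apply: contra ndu.
  by apply: submx_trans; apply: submx_trans (addsmxSl _ _); rewrite genmxE.
pose I : finType := {e : 'I_n | L e}.
have cardI : #|{: I}| = (\sum_(e < n) L e)%N.
  by rewrite card_sig -sum1_card big_mkcond.
(* A column of the cokernel of [T e] is a linear form killing [T e] but not [u (n - e)]. *)
have /fin_all_exists2[xi xi0 xi1] : forall e : I, exists2 xi : 'cV['F_p]_n.+1,
    T (val e) *m xi = 0 & (u (n - val e)%N *m xi) 0 0 != 0.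
  case=> e /= /negP; rewrite submxE => /negP/eqP ne0.
  have [j nej] : exists j, (u (n - e)%N *m cokermx (T e)) 0 j != 0.
    apply/existsP; apply: contra_notT ne0 => /existsPn all0.
    by apply/rowP => j; have := all0 j; rewrite negbK => /eqP ->; rewrite mxE.
  exists (col j (cokermx (T e))); first by rewrite colE mulmxA mulmx_coker mul0mx.
  by rewrite colE mulmxA -colE mxE.
have xiT (e : I) (v : 'rV_n.+1) : (v <= T (val e))%MS -> (v *m xi e) 0 0 = 0.
  by case/submxP=> a ->; rewrite -mulmxA xi0 mulmx0 mxE.
pose l (e : I) := (n - val e)%N.
(* The coordinate [xi e] along the curve. All [u j] with j > n - e lie in [T e] and are killed, so
   its degree is exactly n - e. *)
pose P (e : I) : {poly 'F_p} := \sum_(j < n.+1) (u j *m xi e) 0 0 *: bin_poly p j.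
have szP e : size (P e) = (l e).+1.
  rewrite /P (bigID (fun j : 'I_n.+1 => (l e < j)%N)) /= big1 ?add0r => [|j lt_j]; last first.
    rewrite xiT ?scale0r //; apply: u_T; apply/andP; split; [exact: lt_j | rewrite -ltnS; apply: ltn_ord].
  have le : (l e < n.+1)%N by rewrite ltnS leq_subr.
  rewrite (bigD1 (Ordinal le)) -?leqNgt //=.
  have sz_le : size ((u (l e) *m xi e) 0 0 *: bin_poly p (l e)) = (l e).+1.
    by rewrite size_scale ?xi1 // size_bin_poly // (leq_ltn_trans _ lt_np) // leq_subr.
  rewrite size_polyDl sz_le //.
  rewrite ltnS; apply: leq_trans (size_sum _ _ _) _; apply/bigmax_leqP => j.
  rewrite -leqNgt => /andP[le_j ne_j]; apply: leq_trans (size_scale_leq _ _) _.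
  rewrite size_bin_poly //; last by apply: leq_ltn_trans lt_np; apply: leq_trans le_j (leq_subr _ _).
  by rewrite ltn_neqAle le_j andbT.
have l_inj : injective l.
  move=> e f; rewrite /l => ef; apply: val_inj; apply: val_inj => /=.
  have le_n (h : I) := ltnW (ltn_ord (val h)).
  exact: etrans (esym (subKn (le_n e))) (etrans (congr1 (subn n) ef) (subKn (le_n f))).
have lk e : (0 < l e <= n)%N by rewrite subn_gt0 ltn_ord leq_subr.
(* The forms [xi e] separate [T n] modulo [W]: descending the chain, either [u (n - e)] already lies
   in [T e], or [xi e] forces its coefficient to be 0. *)
have sep (v : 'rV_n.+1) : (v <= T n)%MS -> (forall e, (v *m xi e) 0 0 = 0) -> (v <= W)%MS.
  move=> vT v0; have : forall k, (k <= n)%N -> (v <= T (n - k)%N)%MS.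
    elim=> [|k IH] lt_kn; first by rewrite subn0.
    have := IH (ltnW lt_kn); have -> : (n - k = (n - k.+1).+1)%N by lia.
    have lt_e : (n - k.+1 < n)%N by lia.
    rewrite T_S; case: (boolP (L (n - k.+1)%N)) => [Le|]; last first.
      rewrite negbK => le_u le_v; apply: submx_trans le_v _.
      by rewrite addsmx_sub submx_refl andbT genmxE.
    pose e : I := exist _ (Ordinal lt_e) Le.
    case/sub_addsmxP=> -[a1 a2] /= vE.
    have : (a1 *m <<u (n - (n - k.+1))%N>> <= u (n - (n - k.+1))%N)%MS.
      by rewrite (submx_trans (submxMl _ _)) ?genmxE.
    case/sub_rVP=> c cE; move: vE; rewrite cE => vE.
    have := v0 e; rewrite vE mulmxDl mxE -scalemxAl mxE [X in _ + X]xiT ?addr0; last exact: submxMl.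
    move/eqP; rewrite mulf_eq0 (negbTE (xi1 e)) orbF => /eqP ->.
    by rewrite scale0r add0r submxMl.
  by move/(_ n (leqnn n)); rewrite subnn.
pose J : finType := ((I * 'I_n.+1) * 'I_n)%type.
exists (T n); split.
  apply: rank_ltmx; rewrite ltmxE (T_mono 0 n) //=; apply: contra nu1W.
  by apply: submx_trans; apply: u_T; rewrite subnn n_gt0.
pose cv (i : 'F_p) := \sum_(j < n.+1) u j *+ 'C(i, j).
(* Every curve point lies in [u 0] plus the span of the other [u j], so a sum of [#|J|] points is
   offset by that multiple of [u 0]. *)
exists (b + u 0%N *+ #|J|) => w wT.
pose t e := ((w + u 0%N *+ #|J|) *m xi e) 0 0.
have [y yt] := horner_sums_surj t p_pr le_np l_inj lk szP.
pose z := \sum_(j : J) cv (y j).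
have zxi e : (z *m xi e) 0 0 = t e.
  rewrite -yt /z mulmx_suml summxE; apply: eq_bigr => j _.
  rewrite /cv /P mulmx_suml summxE horner_sum; apply: eq_bigr => i _.
  rewrite hornerZ horner_bin_poly //; last by apply: leq_trans (ltn_ord i) lt_np.
  by rewrite -scaler_nat -scalemxAl mxE mulrC.
have zT : (z - u 0%N *+ #|J| <= T n)%MS.
  rewrite /z -sumr_const -sumrB; apply: summx_sub => j _.
  rewrite /cv big_ord_recl bin0 mulr1n addrAC subrr add0r; apply: summx_sub => i _.
  by rewrite -scaler_nat scalemx_sub // u_T // subnn /= /bump add1n ltn_ord.
(* The curve points match the target in every coordinate [xi e]; the remaining error lies in [W] and
   is absorbed by the part already covered. *)
have : (w + u 0%N *+ #|J| - z <= W)%MS.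
  apply: sep => [|e]; last by rewrite mulmxBl [LHS]mxE [X in _ + X]mxE zxi subrr.
  by rewrite -addrA addmx_sub // -opprB eqmx_opp.
move/bW => bz.
have -> : b + u 0%N *+ #|J| + w = (b + (w + u 0%N *+ #|J| - z)) + z.
  by rewrite -!addrA addNr addr0 [w + _]addrC.
have zD : z \in sumset #|J| D by apply: sumset_sum => j; apply: uD.
apply: sumset_leq (sumsetD bz zD) => //; rewrite leq_add2l.
rewrite !card_prod !card_ord cardI -mulnA leq_mul2r; apply/orP; right.
by have := rankT n; lia.
Qed.

Lemma covers_leq (p n m m' : nat) (D : {set 'rV['F_p]_n.+1}) (W : 'M['F_p]_n.+1) :
  0 \in D -> (m <= m')%N -> covers D W m -> covers D W m'.
Proof. by move=> D0 le_mm' [b bW]; exists b => v /bW; apply: sumset_leq. Qed.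

(** * Irreducibility and elements of order p *)

(** The span [U] of the orbit of [y] is a nonzero submodule, hence everything; an orbit inside [W]
    would make [W] full. *)
Lemma irreducible_moves_out (p n : nat) (G : {group {'GL_n.+1['F_p]}})
    (W : 'M['F_p]_n.+1) (y : 'rV['F_p]_n.+1) :
    irreducible_GL G -> y != 0 -> ~~ row_full W ->
  exists2 h, h \in G & ~~ (y *m GLval h <= W)%MS.
Proof.
case/mx_irrP=> _ irrG y_neq0 nfullW; apply/exists_inP; apply: contraR nfullW.
move/exists_inPn => yW.
pose U : 'M['F_p]_n.+1 := (\sum_(h in G) <<y *m GLval h>>)%MS.
have U_sub (h : {'GL_n.+1['F_p]}) : h \in G -> (y *m GLval h <= U)%MS.
  by move=> hG; rewrite (sumsmx_sup h) // genmxE.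
have /irrG : mxmodule (subg_repr (GLrepr 'F_p n) (subsetT G)) U.
  apply/mxmoduleP => g gG; rewrite /U sumsmxMr; apply/sumsmx_subP => h hG.
  rewrite (eqmxMr _ (genmxE _)) /= -mulmxA.
  have -> : GLval h *m GLval g = GLval (h * g)%g by [].
  by apply: U_sub; rewrite groupM.
have /[swap]/[apply] : U != 0.
  apply: contraNneq y_neq0 => U0; have := U_sub 1%g (group1 G).
  by rewrite U0 submx0 /= mulmx1.
rewrite -!sub1mx => /submx_trans; apply; apply/sumsmx_subP => h hG.
by rewrite genmxE; have := yW h hG; rewrite negbK.
Qed.

(** The minimal polynomial divides X^k, so it is a power of X, and its degree is at most that of the
    characteristic polynomial. *)
Lemma nilpotent_mx_expr0 (F : fieldType) (n k : nat) (N : 'M[F]_n.+1) :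
  N ^+ k = 0 -> N ^+ n.+1 = 0.
Proof.
move=> Nk; have dvdk : mxminpoly N %| ('X - 0%:P) ^+ k.
  by apply: mxminpoly_min; rewrite subr0 rmorphXn /= horner_mx_X.
have /dvdp_exp_XsubCP[j _ minE] := dvdk.
have le_j : (j <= n.+1)%N.
  have := dvdp_leq (monic_neq0 (char_poly_monic N)) (mxminpoly_dvd_char N).
  by rewrite (eqp_size minE) size_char_poly size_exp_XsubC.
have : mxminpoly N %| ('X - 0%:P) ^+ n.+1.
  by rewrite (eqp_dvdl _ minE) dvdp_exp2l.
case/dvdpP=> q qE; have := congr1 (horner_mx N) qE.
by rewrite rmorphM /= mx_root_minpoly mulr0 subr0 rmorphXn /= horner_mx_X.
Qed.

Lemma expr1D_nilpotent (R : pzRingType) (x : R) (d i : nat) :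
  x ^+ d = 0 -> (1 + x) ^+ i = \sum_(j < d) x ^+ j *+ 'C(i, j).
Proof.
move=> xd; rewrite exprDn_comm; last exact: commr_sym (commr1 x).
under eq_bigr do rewrite expr1n mul1r.
pose f j := x ^+ j *+ 'C(i, j).
have fd j : (d <= j)%N -> f j = 0.
  by move=> /subnK dj; rewrite /f -dj exprD xd mulr0 mul0rn.
have fi j : (i < j)%N -> f j = 0 by move=> ij; rewrite /f bin_small ?mulr0n.
rewrite -(big_mkord xpredT f) -[RHS](big_mkord xpredT f).
have tail a b : (forall j, (a <= j)%N -> f j = 0) -> \sum_(a <= j < b) f j = 0.
  by move=> f0; rewrite big_nat big1 // => j /andP[/f0].
transitivity (\sum_(0 <= j < maxn d i.+1) f j).
  by rewrite [RHS](big_cat_nat (n := i.+1)) ?leq_maxr //= (tail i.+1) ?addr0.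
by rewrite (big_cat_nat (n := d)) ?leq_maxl //= (tail d) ?addr0.
Qed.

(** In characteristic p, (g - 1)^p = g^p - 1 = 0. *)
Lemma GLval_order_p_nilpotent (p n : nat) (g : {'GL_n.+1['F_p]}) :
  prime p -> #[g]%g = p -> (GLval g - 1 : 'M['F_p]_n.+1) ^+ n.+1 = 0.
Proof.
move=> p_pr og; apply: (@nilpotent_mx_expr0 _ n p).
have pM : p \in [pchar 'M['F_p]_n.+1].
  by rewrite inE p_pr -scaler_nat pchar_Fp_0 // scale0r eqxx.
rewrite -(pFrobenius_autE pM) pFrobenius_autB_comm; last exact: commr1.
rewrite !pFrobenius_autE expr1n.
have gp : (g ^+ p = 1)%g by apply/eqP; rewrite -order_dvdn og.
have := repr_mxX (GLrepr 'F_p n) p (in_setT g); rewrite /= gp => <-.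
by rewrite subrr.
Qed.

(** * Growth of the covered subspace and the diameter bound *)

Lemma covers_step (p n m : nat) (G : {group {'GL_n.+1['F_p]}}) (v : 'rV['F_p]_n.+1)
    (W : 'M['F_p]_n.+1) :
    prime p -> irreducible_GL G -> (p %| #|G|)%N -> v != 0 -> ~~ row_full W ->
    covers (0 |: Gorbit G v) W m ->
  exists W' : 'M_n.+1, (\rank W < \rank W')%N /\
    covers (0 |: Gorbit G v) W' (m + (\rank W' - \rank W) * n.+1 ^ 2).
Proof.
move=> p_pr irrG pG v_neq0 nfullW; set D := 0 |: _ => covW.
have D0 : 0 \in D by rewrite !inE eqxx.
have orbD h : h \in G -> v *m GLval h \in D.
  by move=> hG; rewrite !inE; apply/orP; right; apply: imset_f.
have [g gG og] := Cauchy p_pr pG.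
pose N : 'M['F_p]_n.+1 := GLval g - 1.
have N_nil : N ^+ n.+1 = 0 := GLval_order_p_nilpotent p_pr og.
have N_neq0 : N != 0.
  rewrite subr_eq0; apply/eqP => g1; have := prime_gt1 p_pr; rewrite -og.
  have -> : g = 1%g by apply: val_inj.
  by rewrite order1.
(* Irreducibility is used twice: first to leave the kernel of [N], then to carry the resulting
   nonzero vector outside [W]. *)
have [h1 h1G /sub_kermxP/eqP y_neq0] : exists2 h, h \in G & ~~ (v *m GLval h <= kermx N)%MS.
  apply: irreducible_moves_out => //; rewrite -sub1mx; apply: contra N_neq0.
  by move/sub_kermxP; rewrite mul1mx => ->.
have [h2 h2G nW] := irreducible_moves_out irrG y_neq0 nfullW.
have mulG (a b c : {'GL_n.+1['F_p]}) : a \in G -> b \in G -> c \in G ->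
    v *m GLval a *m GLval b *m GLval c \in D.
  move=> aG bG cG; rewrite -!mulmxA.
  have -> : GLval a *m (GLval b *m GLval c) = GLval (a * (b * c))%g by [].
  by apply: orbD; rewrite !groupM.
have lt_step W' : (\rank W < \rank W')%N -> (0 < \rank W' - \rank W)%N by rewrite subn_gt0.
(* For p - 1 < n^2 a line through two orbit points is cheap enough; otherwise the curve step
   applies. *)
have [le_np|lt_pn] := leqP (n ^ 2) p.-1; last first.
  have := @covers_line_step p n m D W (v *m GLval h1 *m GLval h2)
    (v *m GLval h1 *m GLval g *m GLval h2) p_pr.
  case=> [|||//|W' [ltW' covW']]; first by rewrite -mulmxA; apply: orbD (groupM h1G h2G).
  - exact: mulG.
  - by rewrite -mulmxBl -{2}[v *m GLval h1]mulmx1 -mulmxBr.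
  exists W'; split=> //; apply: covers_leq covW' => //.
  rewrite leq_add2l; apply: leq_trans (ltnW lt_pn) _.
  apply: (@leq_trans (n.+1 ^ 2)); first by rewrite leq_sqr.
  by rewrite leq_pmull // lt_step.
have n_gt0 : (0 < n)%N.
  rewrite lt0n; apply: contra N_neq0 => /eqP n0.
  by have := N_nil; rewrite [in X in _ ^+ X]n0 expr1 => ->.
pose u j := v *m GLval h1 *m N ^+ j *m GLval h2.
have uD (i : nat) : \sum_(j < n.+1) u j *+ 'C(i, j) \in D.
  have -> : \sum_(j < n.+1) u j *+ 'C(i, j) = v *m GLval h1 *m (1 + N) ^+ i *m GLval h2.
    rewrite (expr1D_nilpotent _ N_nil) mulmx_sumr mulmx_suml; apply: eq_bigr => j _.
    by rewrite -!scaler_nat -scalemxAr -scalemxAl.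
  have -> : (1 + N) ^+ i = GLval (g ^+ i)%g.
    by rewrite addrC subrK; have := repr_mxX (GLrepr 'F_p n) i (in_setT g).
  by apply: mulG => //; apply: groupX.
have nuW : ~~ (u 1%N <= W)%MS by rewrite /u expr1.
have [W' [ltW' covW']] := covers_curve_step p_pr n_gt0 le_np D0 uD nuW covW.
exists W'; split=> //; apply: covers_leq covW' => //.
by rewrite leq_add2l leq_mul2l -mulnn leq_mul2l leqnSn !orbT.
Qed.

Theorem theorem1p1 (p n : nat) (G : {group {'GL_n.+1['F_p]}}) :
  prime p ->
  irreducible_GL G ->
  (p %| #|G|)%N ->
  dirdiam_le G (9 * n.+1 ^ 3).
Proof.
move=> p_pr irrG pG; exists (n.+1 ^ 3)%N; split; rewrite ?expn_gt0 ?leq_pmull //.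
move=> v v_neq0; set D := 0 |: _.
have D0 : 0 \in D by rewrite !inE eqxx.
(* Each gained dimension costs at most d^2 orbit elements, starting from the zero subspace at cost
   0; full rank d therefore costs d^3. *)
have grow r : (r <= n.+1)%N -> exists2 W : 'M['F_p]_n.+1,
    (r <= \rank W)%N & covers D W (\rank W * n.+1 ^ 2).
  elim: r => [|r IH] le_r.
    exists 0 => //; exists 0 => w; rewrite submx0 => /eqP ->.
    by rewrite mxrank0 mul0n add0r inE.
  have [W rW covW] := IH (ltnW le_r).
  have [fullW|nfullW] := boolP (row_full W); first by exists W => //; rewrite (eqP fullW).
  have [W' [ltW covW']] := covers_step p_pr irrG pG v_neq0 nfullW covW.
  exists W'; first exact: leq_ltn_trans ltW.
  by rewrite -mulnDl subnKC ?(ltnW ltW) in covW'.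
have [W rW [b bW]] := grow n.+1 (leqnn _).
have fullW : row_full W by rewrite /row_full eqn_leq rank_leq_row.
apply/setP => t; rewrite inE -[t](subrK b) addrC.
apply: sumset_leq (bW _ _) => //; last exact: submx_full.
by rewrite (expnS _ 2) leq_mul2r rank_leq_row orbT.
Qed.
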